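(* Let $n,k\ge 1$, let $A_0$ be an $n\times k$ real matrix of rank $k$, let $a$ be a $1\times k$ real row vector, and let $A_1=\begin{bmatrix}A_0\\ a\end{bmatrix}$. Let $\sigma^2\ge 0$ and suppose $D=\sigma^2 I$, where $I$ is the $n\times n$ identity matrix. Then, with $W$, $W_{11}$ and $d_{n+1}$ as defined in the context, $$W_{11}=\sigma^2\left(2-\frac{d_{n+1}}{1+d_{n+1}}\right)W,$$ and, consequently, $W_{11}$ is non-negative definite.
   Context: Notation: $A_{00}=A_0^TA_0$ and $A_{11}=A_1^TA_1=A_{00}+a^Ta$; $d_{n+1}=aA_{00}^{-1}a^T$ and $q_{n+1}=1+d_{n+1}$; $$W=\frac{1}{q_{n+1}}A_{00}^{-1}a^Ta A_{00}^{-1},\qquad D_{11}=A_0^TDA_0,\qquad W_{11}=A_{00}^{-1}D_{11}A_{00}^{-1}-A_{11}^{-1}D_{11}A_{11}^{-1}.$$ In the underlying heteroscedastic linear model with uncorrelated errors, $D=\mathbf{\Sigma}_{00}-\sigma_{n+1}^2I$, where $\mathbf{\Sigma}_{00}$ is the diagonal covariance matrix of the first $n$ observations and $\sigma_{n+1}^2$ is the variance of the $(n+1)$-th observation. *)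

(* Defs.v *)
From mathcomp Require Import all_boot all_order all_algebra.
From mathcomp Require Import reals.
Import Order.TTheory GRing.Theory Num.Theory.

Set Implicit Arguments.
Unset Strict Implicit.
Unset Printing Implicit Defensive.

Local Open Scope ring_scope.

Section Definitions.
Variables (R : realType) (n k : nat).
Variables (A0 : 'M[R]_(n, k)) (a : 'rV[R]_k) (D : 'M[R]_n).

Definition A1 : 'M[R]_(n + 1, k) := col_mx A0 a.

Definition A00 : 'M[R]_k := A0^T *m A0.

Definition A11 : 'M[R]_k := A1^T *m A1.

(* d_{n+1}, for the (n+1)-th observation, whose row is a. *)
Definition d_next : R := (a *m invmx A00 *m a^T) 0 0.

Definition q_next : R := 1 + d_next.

Definition W : 'M[R]_k :=
  q_next^-1 *: (invmx A00 *m a^T *m a *m invmx A00).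

Definition D11 : 'M[R]_k := A0^T *m D *m A0.

Definition W11 : 'M[R]_k :=
  invmx A00 *m D11 *m invmx A00
  - invmx A11 *m D11 *m invmx A11.

(* Symmetry is part of the notion, as is usual for real matrices. *)
Definition nonneg_definite (M : 'M[R]_k) : Prop :=
  M^T = M /\ forall x : 'cV[R]_k, 0 <= (x^T *m M *m x) 0 0.

End Definitions.

(* Main.v *)
Require Import Defs.
From mathcomp Require Import all_boot all_order all_algebra.
From mathcomp Require Import reals.
Import Order.TTheory GRing.Theory Num.Theory.
Local Open Scope ring_scope.

(** Write P for the inverse of [A00] and d, q for [d_next], [q_next].  Since
    A1 stacks the row a below A0, [A11] is the rank-one perturbation
    [A00 + a^T *m a], and the Sherman-Morrison formula ([invmx_rank1_update])
    says that its inverse is P - W.  When D is the scalar matrix sigma2, [D11]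
    is sigma2 times [A00], so [W11] equals
      sigma2 (P - (P - W) A00 (P - W)) = sigma2 (2 W - W A00 W).
    The two inner factors P of W A00 W meet around [A00] and leave the scalar
    a P a^T = d, hence W A00 W = (d / q) W ([W_A00_W]): this is the announced
    formula.

    Everything else is positivity.  Full column rank makes the Gram matrix
    [A00] invertible ([gram_unitmx]), and d is the squared length of A0 P a^T
    ([d_next_ge0]), so q >= 1 and the factor 2 - d / q = 1 + 1 / q is positive.
    As W is symmetric and its quadratic form at x is (a P x)^2 / q
    ([W_nonneg]), it is non-negative definite, and so is every non-negative
    multiple of it. *)

(** The product of the perturbed matrix with the proposed inverse is checked
    directly; the 1 x 1 block v M^-1 u is a scalar and commutes with
    everything. *)
Lemma invmx_rank1_update (F : fieldType) (k : nat) (M : 'M[F]_k)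
    (u : 'cV[F]_k) (v : 'rV[F]_k) (q := 1 + (v *m invmx M *m u) 0 0) :
    M \in unitmx -> q != 0 ->
  invmx (M + u *m v)
    = invmx M - q^-1 *: (invmx M *m u *m v *m invmx M).
Proof.
move=> uM q0; set P := invmx M; set B := _ - _.
have prod1 : (M + u *m v) *m B = 1%:M.
  rewrite /B mulmxBr -scalemxAr !mulmxDl mulmxV // !mulmxA mulmxV // mul1mx.
  rewrite -(mulmxA u v P) -(mulmxA u (v *m P) u) [v *m P *m u]mx11_scalar.
  rewrite mul_mx_scalar -!scalemxAl -(mulmxA u v P).
  rewrite -{2}[u *m (v *m P)]scale1r -scalerDl.
  by rewrite scalerA mulVf // scale1r addrK.
have [uMuv _] := mulmx1_unit prod1.
by rewrite -[LHS]mulmx1 -prod1 mulKmx.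
Qed.

Lemma tr_mul_self (R : pzRingType) (n : nat) (x : 'cV[R]_n) :
  (x^T *m x) 0 0 = \sum_i x i 0 ^+ 2.
Proof. by rewrite mxE; apply: eq_bigr => i _; rewrite mxE expr2. Qed.

Lemma tr_mul_self_ge0 (R : realDomainType) (n : nat) (x : 'cV[R]_n) :
  0 <= (x^T *m x) 0 0.
Proof. by rewrite tr_mul_self sumr_ge0 // => i _; rewrite sqr_ge0. Qed.

Lemma tr_mul_self_eq0 (R : realDomainType) (n : nat) (x : 'cV[R]_n) :
  (x^T *m x) 0 0 = 0 -> x = 0.
Proof.
rewrite tr_mul_self => /eqP.
rewrite psumr_eq0 => [/allP x0|i _]; last by rewrite sqr_ge0.
apply/colP => i; apply/eqP; rewrite mxE -sqrf_eq0.
exact: x0 (mem_index_enum i).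
Qed.

(** Over an ordered field the Gram matrix has the same kernel as the matrix:
    if A^T A x = 0 then A x has squared length x^T A^T A x = 0. *)
Lemma gram_unitmx (R : realFieldType) (n k : nat) (A : 'M[R]_(n, k)) :
  \rank A = k -> A^T *m A \in unitmx.
Proof.
move=> rA; rewrite -row_free_unit; apply: inj_row_free => x xG.
have Ax0 : A *m x^T = 0.
  apply: tr_mul_self_eq0; rewrite trmx_mul trmxK mulmxA -(mulmxA x).
  by rewrite xG mul0mx mxE.
have fA : row_free A^T by rewrite /row_free mxrank_tr rA.
apply: (row_free_inj fA); rewrite mul0mx.
by apply: trmx_inj; rewrite trmx_mul trmxK Ax0 trmx0.
Qed.

Lemma nonneg_definiteZ (R : realType) (k : nat) (c : R) (M : 'M[R]_k) :
  0 <= c -> nonneg_definite M -> nonneg_definite (c *: M).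
Proof.
move=> c0 [Msym Mge0]; split=> [|x]; first by rewrite linearZ /= Msym.
by rewrite -scalemxAr -scalemxAl mxE mulr_ge0.
Qed.

Lemma A11E (R : realType) (n k : nat) (A0 : 'M[R]_(n, k)) (a : 'rV[R]_k) :
  A11 A0 a = A00 A0 + a^T *m a.
Proof. by rewrite /A11 /A1 tr_col_mx mul_row_col. Qed.

Lemma tr_invmx_A00 (R : realType) (n k : nat) (A0 : 'M[R]_(n, k)) :
  (invmx (A00 A0))^T = invmx (A00 A0).
Proof. by rewrite trmx_inv /A00 trmx_mul trmxK. Qed.

Lemma d_next_ge0 (R : realType) (n k : nat) (A0 : 'M[R]_(n, k)) (a : 'rV[R]_k) :
  A00 A0 \in unitmx -> 0 <= d_next A0 a.
Proof.
move=> uA; have := tr_mul_self_ge0 _ _ (A0 *m invmx (A00 A0) *m a^T).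
rewrite !trmx_mul trmxK tr_invmx_A00 !mulmxA -(mulmxA _ A0^T A0) -/(A00 A0).
by rewrite mulmxKV.
Qed.

Lemma q_next_gt0 (R : realType) (n k : nat) (A0 : 'M[R]_(n, k)) (a : 'rV[R]_k) :
  A00 A0 \in unitmx -> 0 < q_next A0 a.
Proof. by move=> uA; rewrite ltr_wpDr ?ltr01 ?d_next_ge0. Qed.

Lemma invmx_A11 (R : realType) (n k : nat) (A0 : 'M[R]_(n, k)) (a : 'rV[R]_k) :
  A00 A0 \in unitmx -> invmx (A11 A0 a) = invmx (A00 A0) - W A0 a.
Proof.
move=> uA; rewrite A11E invmx_rank1_update //.
by have := q_next_gt0 _ _ _ _ a uA => /lt0r_neq0.
Qed.

(** The inner factors collapse to the scalar a A00^-1 a^T = d, and one of the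
    two factors 1 / q is absorbed in W. *)
Lemma W_A00_W (R : realType) (n k : nat) (A0 : 'M[R]_(n, k)) (a : 'rV[R]_k) :
    A00 A0 \in unitmx ->
  W A0 a *m A00 A0 *m W A0 a = (d_next A0 a / q_next A0 a) *: W A0 a.
Proof.
move=> uA; rewrite {1 2}/W; set P := invmx _.
rewrite -!scalemxAl -scalemxAr mulmxKV // !mulmxA.
rewrite -(mulmxA (P *m a^T) a P) -(mulmxA _ (a *m P) a^T) [a *m P *m a^T]mx11_scalar.
rewrite -/(d_next A0 a) mul_mx_scalar -!scalemxAl /W !scalerA.
by congr (_ *: _); rewrite mulrC [X in X * _]mulrC.
Qed.

(** W is the rank-one matrix (a P)^T (a P) divided by the positive q. *)
Lemma W_nonneg (R : realType) (n k : nat) (A0 : 'M[R]_(n, k)) (a : 'rV[R]_k) :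
  A00 A0 \in unitmx -> nonneg_definite (W A0 a).
Proof.
move=> uA; apply: nonneg_definiteZ; first by rewrite invr_ge0 ltW ?q_next_gt0.
split=> [|x]; first by rewrite !trmx_mul trmxK tr_invmx_A00 !mulmxA.
have := tr_mul_self_ge0 _ _ (a *m invmx (A00 A0) *m x).
by rewrite !trmx_mul tr_invmx_A00 !mulmxA.
Qed.

Theorem theorem1 (R : realType) (n k : nat) (hn : (1 <= n)%N) (hk : (1 <= k)%N)
  (A0 : 'M[R]_(n, k)) (hA0 : \rank A0 = k) (a : 'rV[R]_k)
  (sigma2 : R) (hsigma2 : 0 <= sigma2)
  (D : 'M[R]_n) (hD : D = sigma2%:M) :
  W11 A0 a D
    = (sigma2 * (2 - d_next A0 a / (1 + d_next A0 a))) *: W A0 a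
  /\ nonneg_definite (W11 A0 a D).
Proof.
have uA : A00 A0 \in unitmx by exact: gram_unitmx.
have W11E : W11 A0 a D
    = (sigma2 * (2 - d_next A0 a / (1 + d_next A0 a))) *: W A0 a.
  have D11E : D11 A0 D = sigma2 *: A00 A0.
    by rewrite /D11 hD mul_mx_scalar -scalemxAl.
  rewrite /W11 D11E invmx_A11 // -!scalemxAr -!scalemxAl -scalerBr.
  rewrite -scalerA mulVmx // mul1mx mulmxBl mulVmx // mulmxBr !mulmxBl !mul1mx.
  rewrite W_A00_W // mulmxK // -/(q_next A0 a).
  congr (_ *: _); rewrite scalerBl scaler_nat mulr2n.
  by rewrite !opprB addrCA [_ + (W A0 a - _)]addrC subrK addrAC.
split=> //; rewrite W11E; apply: nonneg_definiteZ; last exact: W_nonneg.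
have q0 : 0 < 1 + d_next A0 a by exact: q_next_gt0.
rewrite mulr_ge0 // subr_ge0 ler_pdivrMr // mulrDr mulr1.
(* Clearing the denominator has left d <= 2 + 2 d. *)
rewrite ler_wpDl // ler_peMl ?d_next_ge0 // ler1n //.
Qed.
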